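(* Let $t,m$ be positive integers, let $r_1,\dots,r_m\in\{-1,1\}^t$ with $r_i=(r_i^1,\dots,r_i^t)$, let $u>\ell>0$ be real numbers, let $\lambda\in\mathbb{N}$ with $\lambda\le m$, let $\bar\eta=\max\{\lambda,m-\lambda\}$, and let $M$ be a valid big-$M$ constant. For each $i\in[1,m]$, let $\mathcal{A}_i=\{j\in[1,t] : r_i^j=-1\}$ and $\mathcal{B}_i=\{j\in[1,t] : r_i^j=1\}$. If for some $i\in[1,m]$ $$\varphi_i:=-u\,|\mathcal{A}_i|+\ell\,|\mathcal{B}_i|\ge 1$$ holds, then every feasible point $(\alpha,\eta,z)$ of Problem (P1) satisfies $z_i=1$. If, on the other hand, $$\phi_i:=-\ell\,|\mathcal{A}_i|+u\,|\mathcal{B}_i|\le -1$$ holds for some $i\in[1,m]$, then every feasible point $(\alpha,\eta,z)$ of Problem (P1) satisfies $z_i=0$.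
   Context: Notation: $[1,k]=\{1,\dots,k\}$ for a positive integer $k$. Here $t$ is the number of decision trees, $m$ the number of unlabeled points, $r_i^j\in\{-1,1\}$ is the classification of the $i$-th unlabeled point by tree $j$, and $\lambda$ is the known total number of the $m$ unlabeled points that belong to the positive class. Problem (P1) is the mixed-integer linear problem in the variables $\alpha\in\mathbb{R}^t$, $\eta\in\mathbb{R}$, $z\in\{0,1\}^m$: $$\min_{\alpha,\eta,z}\ \eta$$ subject to $$\alpha^\top r_i\le -1+z_iM,\quad i\in[1,m],$$ $$\alpha^\top r_i\ge 1-(1-z_i)M,\quad i\in[1,m],$$ $$\lambda-\eta\le\sum_{i=1}^m z_i\le\lambda+\eta,$$ $$\ell\le\alpha_j\le u,\quad j\in[1,t],$$ $$0\le\eta\le\bar\eta,$$ $$z_i\in\{0,1\},\quad i\in[1,m].$$ The constant $M$ is assumed sufficiently large (''valid''), i.e., every $(\alpha,\eta,z)$ that satisfies all constraints of (P1) other than the two big-$M$ constraints and satisfies, for every $i\in[1,m]$, ''$\alpha^\top r_i\le -1$ if $z_i=0$ and $\alpha^\top r_i\ge 1$ if $z_i=1$'', also satisfies the two big-$M$ constraints; for instance $M=ut+1$. *)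

(* Defs.v *)
From HB Require Import structures.
From mathcomp Require Import all_boot all_order all_algebra.
From mathcomp Require Import reals.

Set Implicit Arguments.
Unset Strict Implicit.
Unset Printing Implicit Defensive.

Import Order.TTheory GRing.Theory Num.Theory.
Local Open Scope ring_scope.

Definition dotv (R : realType) (t : nat) (x y : 'cV[R]_t) : R :=
  (x^T *m y) 0 0.

Definition eta_bar (R : realType) (m lambda : nat) : R :=
  Num.max lambda%:R (m%:R - lambda%:R).

(* The binary vector z is real-valued; integrality is one of the constraints
   collected in P1_other. *)
Definition P1_bigM (R : realType) (t m : nat) (r : 'I_m -> 'cV[R]_t) (M : R)
    (alpha : 'cV[R]_t) (z : 'cV[R]_m) : Prop :=
  (forall i : 'I_m, dotv alpha (r i) <= -1 + z i 0 * M) /\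
  (forall i : 'I_m, dotv alpha (r i) >= 1 - (1 - z i 0) * M).

Definition P1_other (R : realType) (t m : nat) (l u : R) (lambda : nat)
    (alpha : 'cV[R]_t) (eta : R) (z : 'cV[R]_m) : Prop :=
  [/\ lambda%:R - eta <= \sum_(i < m) z i 0 <= lambda%:R + eta,
      forall j : 'I_t, l <= alpha j 0 <= u,
      0 <= eta <= eta_bar R m lambda
    & forall i : 'I_m, z i 0 = 0 \/ z i 0 = 1].

Definition P1_feasible (R : realType) (t m : nat) (r : 'I_m -> 'cV[R]_t)
    (l u : R) (lambda : nat) (M : R)
    (alpha : 'cV[R]_t) (eta : R) (z : 'cV[R]_m) : Prop :=
  P1_bigM r M alpha z /\ P1_other l u lambda alpha eta z.

Definition valid_bigM (R : realType) (t m : nat) (r : 'I_m -> 'cV[R]_t)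
    (l u : R) (lambda : nat) (M : R) : Prop :=
  forall (alpha : 'cV[R]_t) (eta : R) (z : 'cV[R]_m),
    P1_other l u lambda alpha eta z ->
    (forall i : 'I_m,
       (z i 0 = 0 -> dotv alpha (r i) <= -1) /\
       (z i 0 = 1 -> 1 <= dotv alpha (r i))) ->
    P1_bigM r M alpha z.

Definition neg_trees (R : realType) (t : nat) (ri : 'cV[R]_t) : {set 'I_t} :=
  [set j | ri j 0 == -1].

Definition pos_trees (R : realType) (t : nat) (ri : 'cV[R]_t) : {set 'I_t} :=
  [set j | ri j 0 == 1].

(* Lower and upper bounds of alpha^T r_i over the box [l, u]^t. *)
Definition varphi (R : realType) (t : nat) (l u : R) (ri : 'cV[R]_t) : R :=
  - u * #|neg_trees ri|%:R + l * #|pos_trees ri|%:R.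

Definition phi (R : realType) (t : nat) (l u : R) (ri : 'cV[R]_t) : R :=
  - l * #|neg_trees ri|%:R + u * #|pos_trees ri|%:R.

(* Main.v *)
Require Import Defs.
From HB Require Import structures.
From mathcomp Require Import all_boot all_order all_algebra.
From mathcomp Require Import reals.

Set Implicit Arguments.
Unset Strict Implicit.
Unset Printing Implicit Defensive.

Import Order.TTheory GRing.Theory Num.Theory.
Local Open Scope ring_scope.

(** On the box [l, u]^t, the linear form alpha |-> alpha^T r_i with a sign
    vector r_i is separable: coordinate j contributes - alpha_j when tree j
    votes -1 and alpha_j when it votes 1.  Minimizing (maximizing) each
    contribution separately over [l, u] gives varphi_i (phi_i), so that
    varphi_i <= alpha^T r_i <= phi_i ([varphi_le_dotv], [dotv_le_phi]).
    At z_i = 0 the first big-M constraint loses its M and reads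
    alpha^T r_i <= -1, which is incompatible with varphi_i >= 1; at z_i = 1
    the second one reads alpha^T r_i >= 1, which is incompatible with
    phi_i <= -1.  As z_i is binary, it must take the other value. *)

Lemma dotvE (R : realType) (t : nat) (x y : 'cV[R]_t) :
  dotv x y = \sum_j x j 0 * y j 0.
Proof. by rewrite /dotv mxE; apply: eq_bigr => j _; rewrite mxE. Qed.

(** This coordinatewise form makes varphi comparable term by term with a dot
    product.  Exchanging a and b turns varphi into phi, so the same identity
    yields the lower and the upper bound. *)
Lemma varphi_sum (R : realType) (t : nat) (a b : R) (ri : 'cV[R]_t)
    (ri_sign : forall j, ri j 0 = -1 \/ ri j 0 = 1) :
  varphi a b ri = \sum_j (if ri j 0 == -1 then - b else a).
Proof.
have one_neqN1 : (1 == -1 :> R) = false.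
  by rewrite gt_eqF // (lt_trans (ltrN10 R) ltr01).
have posE : pos_trees ri = ~: neg_trees ri.
  apply/setP => j; rewrite !inE; case: (ri_sign j) => ->; rewrite eqxx.
    by rewrite eq_sym.
  by rewrite one_neqN1.
rewrite /varphi posE !mulr_natr -!sumr_const.
rewrite [RHS](bigID [in neg_trees ri]) /=; congr (_ + _).
  by apply: eq_bigr => j; rewrite inE => ->.
apply: eq_big => [j | j]; first by rewrite inE.
by rewrite !inE => /negbTE ->.
Qed.

Lemma varphi_le_dotv (R : realType) (t : nat) (l u : R) (alpha ri : 'cV[R]_t)
    (ri_sign : forall j, ri j 0 = -1 \/ ri j 0 = 1)
    (alpha_box : forall j, l <= alpha j 0 <= u) :
  varphi l u ri <= dotv alpha ri.
Proof.
rewrite varphi_sum // dotvE; apply: ler_sum => j _.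
have /andP[le_l le_u] := alpha_box j.
have [-> | neq] := eqVneq (ri j 0) (-1); first by rewrite mulrN1 lerN2.
by case: (ri_sign j) neq => ->; rewrite ?eqxx ?mulr1.
Qed.

Lemma dotv_le_phi (R : realType) (t : nat) (l u : R) (alpha ri : 'cV[R]_t)
    (ri_sign : forall j, ri j 0 = -1 \/ ri j 0 = 1)
    (alpha_box : forall j, l <= alpha j 0 <= u) :
  dotv alpha ri <= phi l u ri.
Proof.
rewrite -[phi l u ri]/(varphi u l ri) varphi_sum // dotvE.
apply: ler_sum => j _.
have /andP[le_l le_u] := alpha_box j.
have [-> | neq] := eqVneq (ri j 0) (-1); first by rewrite mulrN1 lerN2.
by case: (ri_sign j) neq => ->; rewrite ?eqxx ?mulr1.
Qed.

Theorem proposition5 (R : realType) (t m : nat) (r : 'I_m -> 'cV[R]_t)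
    (l u : R) (lambda : nat) (M : R)
    (t_gt0 : (0 < t)%N) (m_gt0 : (0 < m)%N)
    (r_sign : forall (i : 'I_m) (j : 'I_t), r i j 0 = -1 \/ r i j 0 = 1)
    (l_gt0 : 0 < l) (l_lt_u : l < u)
    (lambda_le_m : (lambda <= m)%N)
    (M_valid : valid_bigM r l u lambda M) :
  (forall i : 'I_m, 1 <= varphi l u (r i) ->
     forall (alpha : 'cV[R]_t) (eta : R) (z : 'cV[R]_m),
       P1_feasible r l u lambda M alpha eta z -> z i 0 = 1) /\
  (forall i : 'I_m, phi l u (r i) <= -1 ->
     forall (alpha : 'cV[R]_t) (eta : R) (z : 'cV[R]_m),
       P1_feasible r l u lambda M alpha eta z -> z i 0 = 0).
Proof.
have absurd1 : (1 <= -1 :> R) = false.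
  by apply/negbTE; rewrite -ltNge; apply: lt_trans (ltrN10 R) ltr01.
split=> i bound alpha eta z [[ub lb] [_ box _ /(_ i)[zi0 | zi1]]] //.
  have := le_trans bound (varphi_le_dotv (r_sign i) box).
  by move=> /le_trans/(_ (ub i)); rewrite zi0 mul0r addr0 absurd1.
have := le_trans (dotv_le_phi (r_sign i) box) bound.
by move=> /(le_trans (lb i)); rewrite zi1 subrr mul0r subr0 absurd1.
Qed.
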